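(* Let $q$ be a prime power. If $q$ is not a prime number then $\varepsilon_q\geq \frac12$.
   Context: A hyperplane of a vector space is a subspace of codimension $1$; an affine hyperplane is a set $H+\mathbf{v}$ with $H$ a hyperplane and $\mathbf{v}$ a vector, and $H$ is the hyperplane corresponding to it. A covering of a space is minimal (irredundant) if none of its members can be omitted. For a prime power $q$ and $n\ge 1$, $l_q(n)$ denotes the minimal number $k$ such that there is a collection of $k$ affine hyperplanes of an $n$-dimensional vector space $V$ over $\mathrm{GF}(q)$ which forms a minimal covering of $V$ and for which the intersection of the corresponding hyperplanes is trivial. The number $\varepsilon_q$ is defined by $1+\varepsilon_q=\inf_{n\ge 1} l_q(n)/n$. *)

(* Defs.v *)
From HB Require Import structures.
From mathcomp Require Import all_boot all_order all_algebra.
From mathcomp Require Import all_classical all_reals.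

Set Implicit Arguments.
Unset Strict Implicit.
Unset Printing Implicit Defensive.

Import Order.TTheory GRing.Theory Num.Theory.
Local Open Scope ring_scope.

Section Coverings.
Variables (F : finFieldType) (V : vectType F).

Definition hyperplane (H : {vspace V}) : Prop := (\dim H).+1 = \dim {:V}.

Definition translate (H : {vspace V}) (v : V) : set V :=
  [set h + v | h in [set` H]]%classic.

Definition minimal_covering (k : nat) (A : 'I_k -> set V) : Prop :=
  (\bigcup_i A i = setT)%classic /\
  forall j : 'I_k, (\bigcup_(i in [set~ j]) A i <> setT)%classic.

(* The members are indexed by 'I_k; minimality forces them to be pairwise
   distinct, so k is the cardinality of the collection. *)
Definition has_hyperplane_covering (k : nat) : Prop :=
  exists (H : 'I_k -> {vspace V}) (v : 'I_k -> V),
    [/\ forall i, hyperplane (H i),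
        minimal_covering (fun i => translate (H i) (v i)) &
        (\bigcap_i H i = 0)%VS].

End Coverings.

Definition is_minimum (P : nat -> Prop) (k : nat) : Prop :=
  P k /\ forall j, P j -> (k <= j)%N.

(* For n > 0 the minimum exists (lqP below); the default 0 is only reached
   for n = 0, where there are no hyperplanes, hence no covering. *)
Definition lq (F : finFieldType) (n : nat) : nat :=
  xget 0%N [set k | is_minimum (@has_hyperplane_covering F 'rV[F]_n) k]%classic.

(* Witness: the hyperplanes x_i = a (a != 0) together with \sum_i x_i = 0; the
   point a e_i lies only on x_i = a, and 0 only on \sum_i x_i = 0. *)
Section Existence.
Variables (F : finFieldType) (n : nat).
Local Notation V := 'rV[F]_n.

Let ker (c : 'cV[F]_n) : {vspace V} := lker (linfun (mulmxr c) : 'Hom(V, 'rV[F]_1)).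

Let mem_ker c (x : V) : (x \in ker c) = (x *m c == 0).
Proof. by rewrite memv_ker lfunE. Qed.

Let ker_hyperplane c : c != 0 -> hyperplane (ker c).
Proof.
move=> c_neq0; pose f : 'Hom(V, 'rV[F]_1) := linfun (mulmxr c).
have := limg_ker_dim f fullv; rewrite -/(ker c) capfv /hyperplane => <-.
suff -> : \dim (limg f) = 1%N by rewrite addn1.
have le1 : (\dim (limg f) <= 1)%N.
  by rewrite (leq_trans (dimvS (subvf _))) // dimvf.
apply/eqP; rewrite eqn_leq le1 lt0n dimv_eq0.
apply: contra c_neq0 => /eqP img0.
apply/eqP/row_matrixP => i; rewrite row0 rowE.
have := memv_img f (memvf (delta_mx 0 i : V)).
by rewrite img0 memv0 lfunE /= => /eqP.
Qed.

Let translate_ker c (v u : V) : translate (ker c) v u <-> u *m c = v *m c.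
Proof.
split=> [[h /= + <-]|uv]; first by rewrite mem_ker mulmxDl => /eqP ->; rewrite add0r.
exists (u - v); last by rewrite subrK.
by rewrite /= mem_ker mulmxBl uv subrr.
Qed.

Let I : finType := option ('I_n * {a : F | a != 0}).

Let c_ (i : I) : 'cV[F]_n :=
  if i is Some p then delta_mx p.1 0 else const_mx 1.
Let v_ (i : I) : V := if i is Some p then val p.2 *: delta_mx 0 p.1 else 0.

Let mul_delta (x : V) i : x *m (delta_mx i 0 : 'cV[F]_n) = (x 0 i)%:M.
Proof.
apply/matrixP => j k; rewrite !ord1 mxE (bigD1 i) //= big1 => [|l li].
  by rewrite !mxE !eqxx mulr1n mulr1 addr0.
by rewrite mxE (negPf li) mulr0.
Qed.

Let v_Some (i : 'I_n) a j : v_ (Some (i, a)) 0 j = val a *+ (j == i).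
Proof. by rewrite !mxE eqxx /= mulr_natr. Qed.

Let scalar_inj (a b : F) : (a%:M : 'M_1) = b%:M -> a = b.
Proof. by move/matrixP/(_ 0 0); rewrite !mxE. Qed.

Let in_Some (i : 'I_n) a (x : V) :
  translate (ker (c_ (Some (i, a)))) (v_ (Some (i, a))) x <-> x 0 i = val a.
Proof.
rewrite translate_ker /c_ !mul_delta v_Some eqxx mulr1n.
by split=> [/scalar_inj|->].
Qed.

Let in_None (x : V) :
  translate (ker (c_ None)) (v_ None) x <-> \sum_j x 0 j = 0.
Proof.
rewrite translate_ker /= mul0mx; split=> [/matrixP/(_ 0 0)|s0].
  by rewrite !mxE => s0; rewrite -[RHS]s0; apply: eq_bigr => j _; rewrite mxE mulr1.
apply/matrixP => i j; rewrite !ord1 !mxE -[RHS]s0.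
by apply: eq_bigr => k _; rewrite mxE mulr1.
Qed.

Let not_covered_but (j : I) :
  exists x : V, forall i, translate (ker (c_ i)) (v_ i) x -> i = j.
Proof.
case: j => [[j a]|].
  exists (v_ (Some (j, a))) => -[[i b]|].
    move/in_Some; rewrite v_Some; case: eqP => [-> /val_inj -> //|_] b0.
    by have := valP b; rewrite -b0 eqxx.
  move/in_None; rewrite (bigD1 j) //= v_Some eqxx big1 => [|k kj].
    by rewrite addr0 => a0; have := valP a; rewrite [val a]a0 eqxx.
  by rewrite v_Some (negPf kj).
exists 0 => -[[i b]|//] /in_Some; rewrite mxE => b0.
by have := valP b; rewrite -b0 eqxx.
Qed.

Lemma hyperplane_covering_exists : (0 < n)%N ->
  exists k, @has_hyperplane_covering F V k.
Proof.
move=> n_gt0; exists #|I|.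
exists (fun i => ker (c_ (enum_val i))), (fun i => v_ (enum_val i)); split.
- move=> i; apply: ker_hyperplane; have i0 := Ordinal n_gt0.
  case: (enum_val i) => [[j a]|] /=; apply/eqP => /matrixP.
    by move/(_ j 0); rewrite !mxE !eqxx => /eqP; rewrite oner_eq0.
  by move/(_ i0 0); rewrite !mxE => /eqP; rewrite oner_eq0.
- split.
    rewrite -subTset => x _.
    have [i xi] : exists i : I, translate (ker (c_ i)) (v_ i) x.
      have [/existsP[j xj]|] := boolP [exists j, x 0 j != 0].
        by exists (Some (j, exist _ (x 0 j) xj)); apply/in_Some.
      rewrite negb_exists => /forallP x0; exists None; apply/in_None.
      by apply: big1 => j _; apply/eqP; rewrite -[_ == _]negbK x0.
    by exists (enum_rank i) => //; rewrite enum_rankK.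
  move=> j jT; have [x xP] := not_covered_but (enum_val j).
  have [i /= ij] : (\bigcup_(i in [set~ j])
      translate (ker (c_ (enum_val i))) (v_ (enum_val i)))%classic x by rewrite jT.
  by move/xP/enum_val_inj.
- apply/eqP; rewrite -subv0; apply/subvP => x.
  rewrite memvE => /subv_bigcapP xP.
  rewrite memv0; apply/eqP/rowP => j; rewrite mxE.
  have a : {a : F | a != 0} by exists 1; rewrite oner_eq0.
  have : x \in ker (c_ (enum_val (enum_rank (Some (j, a) : I)))) by rewrite memvE xP.
  rewrite enum_rankK mem_ker mul_delta => /eqP/matrixP/(_ 0 0).
  by rewrite !mxE.
Qed.

End Existence.

Lemma lqP (F : finFieldType) (n : nat) : (0 < n)%N ->
  is_minimum (@has_hyperplane_covering F 'rV[F]_n) (lq F n).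
Proof.
move=> /(@hyperplane_covering_exists F) [k0 Pk0].
have exP : exists k, `[< @has_hyperplane_covering F 'rV[F]_n k >].
  by exists k0; apply/asboolP.
rewrite /lq; apply: (@xgetI _ 0%N _ (ex_minn exP)).
by case: ex_minnP => k /asboolP Pk kmin; split=> // j Pj; apply/kmin/asboolP.
Qed.

Definition epsilon (R : realType) (F : finFieldType) : R :=
  inf [set (lq F n)%:R / n%:R | n in [set n | (0 < n)%N]]%classic - 1.

(* Main.v *)
Require Import Defs.
From mathcomp Require Import all_boot all_fingroup all_solvable.

(* Idea: only the additive p-group structure of V is used. If a finite p-group G
   is minimally covered by k left cosets of subgroups with trivial intersection,
   then |G| <= p ^ k. With G = GF(p ^ m) ^ n this gives m * n <= k, and m >= 2
   when q = p ^ m is not prime.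
   For the group statement, write H_X for the intersection of the H i, i in X.
   If |G : H_X| > p ^ #|X| for all nonempty X, then the cosets do not cover G.
   So some nonempty X satisfies |G : H_X| <= p ^ #|X|; take a maximal one. If X
   is not everything, a member h outside X has a private point b, the coset
   b H_X avoids the members of X, and induction applied to a minimal subcover of
   b H_X by the other members (it contains h) enlarges X. *)

(** * Coverings of a coset in a finite p-group *)

Section CosetCoverings.
Local Open Scope group_scope.
Context {gT : finGroupType} {I : finType} (H : I -> {group gT}).
Implicit Types (W : {group gT}) (X Y C D E : {set I}).

Definition meet_group W X : {group gT} := (W :&: \bigcap_(i in X) H i)%G.

Lemma meet_group0 W : meet_group W set0 = W.
Proof. by apply/val_inj; rewrite /= big_set0 setIT. Qed.

Lemma meet_groupU W X Y : meet_group (meet_group W X) Y = meet_group W (X :|: Y).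
Proof. by apply/val_inj; rewrite /= bigcap_setU setIA. Qed.

Lemma meet_group_sub W X : meet_group W X \subset W.
Proof. exact: subsetIl. Qed.

Lemma meet_group_subH W X i : i \in X -> meet_group W X \subset H i.
Proof. by move=> iX; apply: subset_trans (subsetIr _ _) (bigcap_inf _ iX). Qed.

Lemma meet_groupSl W W' X :
  W \subset W' -> meet_group W X \subset meet_group W' X.
Proof. exact: setSI. Qed.

Context (p : nat) (p_pr : prime p) (v : I -> gT).

(* Induction on E: a tight set X (equality in the hypothesis) splits the problem
   into X, and E :\: X inside a coset of meet_group W X; without tight sets one
   can afford to pass to a subgroup of index p, one of whose cosets avoids a
   given member. *)
Lemma lcosets_not_cover E W a : p.-group W ->
  (forall X, X \subset E -> #|X| + logn p #|meet_group W X| <= logn p #|W|)%N ->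
  exists2 x, x \in a *: W & forall i, i \in E -> x \notin v i *: H i.
Proof.
have [n] := ubnP #|E|; elim: n E W a => // n IHn E W a.
rewrite ltnS => leEn pW radoE.
have [->|[e eE]] := set_0Vmem E.
  by exists a => [|i]; rewrite ?lcoset_refl // inE.
have [/existsP[X /and4P[XE X0 XnE /eqP tight]]|/existsPn no_tight] :=
  boolP [exists X : {set I}, [&& X \subset E, X != set0, X != E &
    #|X| + logn p #|meet_group W X| == logn p #|W|]%N].
  have [||b bW bX] := IHn X W a _ pW.
  - by apply: leq_trans leEn; rewrite proper_card // properEneq XnE.
  - by move=> Y YX; rewrite radoE // (subset_trans YX).
  have [|||x xb xE] := IHn (E :\: X) (meet_group W X) b.
  - apply: leq_trans leEn; apply: proper_card.
    have [i iX] := set0Pn _ X0; rewrite properE subsetDl.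
    by apply/subsetPn; exists i; rewrite ?(subsetP XE) // inE iX.
  - exact: pgroupS (meet_group_sub _ _) pW.
  - move=> Y; rewrite subsetD disjoint_sym => /andP[YE dXY].
    have XYE : X :|: Y \subset E by rewrite subUset XE.
    have := radoE _ XYE; rewrite -tight meet_groupU.
    by rewrite cardsU (disjoint_setI0 dXY) cards0 subn0 -addnA leq_add2l.
  exists x.
    rewrite -(lcoset_eqP bW); apply: subsetP xb.
    by rewrite mulgS ?meet_group_sub.
  (* For [i] in [X], [meet_group W X] lies in [H i], so a member meeting [b *: meet_group W X] would
     contain [b]. *)
  move=> i iE; have [iX|iX] := boolP (i \in X); last by rewrite xE // inE iX.
  apply: contra (bX i iX) => xi; rewrite -(lcoset_eqP xi) lcoset_sym.
  by apply: subsetP xb; rewrite mulgS ?meet_group_subH.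
have {}no_tight X : X \subset E -> X != set0 -> X != E ->
    (#|X| + logn p #|meet_group W X| < logn p #|W|)%N.
  move=> XE X0 XnE; rewrite ltn_neqAle radoE // andbT.
  by have := no_tight X; rewrite XE X0 XnE.
(* The hypothesis for [[set e]] makes the trace of [H e] on [W] proper, so it lies in a maximal
   subgroup [M], of index p. *)
have [eW|[M maxM eM]] := maximal_exists (meet_group_sub W [set e]).
  have /radoE : [set e] \subset E by rewrite sub1set.
  by rewrite cards1 eW ltnn.
have sMW := maxgroupp maxM; have {}sMW := proper_sub sMW.
have indM := p_maximal_index pW maxM.
have logM : logn p #|W| = (logn p #|M|).+1.
  rewrite -(Lagrange sMW) indM lognM ?cardG_gt0 ?prime_gt0 //.
  by rewrite (logn_prime p p_pr) eqxx addn1.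
(* Two points of [a *: W] in [v e *: H e] differ by an element of [M], so this member meets a single
   coset of [M]; were every coset met, [W] would equal [M]. *)
have [b bW be] : exists2 b, b \in a *: W & [disjoint b *: M & v e *: H e].
  have [b /= /andP[bW be]|none] := pickP [pred b | b \in a *: W & [disjoint b *: M & v e *: H e]].
    by exists b.
  have meets b : b \in a *: W -> exists2 y, y \in b *: M & y \in v e *: H e.
    move=> bW; have := none b; rewrite /= bW /= => /negbT.
    by case/pred0Pn => y /= /andP[]; exists y.
  have [y ya yv] := meets a (lcoset_refl _ _).
  have yW : y \in a *: W by apply: subsetP ya; rewrite mulgS.
  have WM : W \subset M.
    apply/subsetP => w wW.
    have ywW : y * w \in a *: W by rewrite -(lcoset_eqP yW) mem_lcoset mulKg.
    have [z zw zv] := meets _ ywW.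
    have zM : y^-1 * z \in M.
      apply: (subsetP eM); rewrite inE /= big_set1 -!mem_lcoset.
      rewrite (lcoset_eqP yv) zv andbT (lcoset_eqP yW) -(lcoset_eqP ywW).
      by apply: subsetP zw; rewrite mulgS.
    have := zw; rewrite mem_lcoset invMg -mulgA => wzM.
    by have := groupM zM (groupVr wzM); rewrite invMg invgK mulgA mulgV mul1g.
  by have := indexg_eq1 W M; rewrite WM indM => /eqP p1; move: p_pr; rewrite p1.
have [|||x xb xE] := IHn (E :\ e) M b.
- by apply: leq_trans leEn; rewrite (cardsD1 e E) eE.
- exact: pgroupS pW.
- move=> X XE; have [->|X0] := eqVneq X set0.
    by rewrite cards0 meet_group0.
  (* Passing to [M] lowers the logarithm by one, which the strict inequality in [no_tight] pays
     for. *)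
  rewrite -ltnS -logM; apply: leq_ltn_trans (no_tight X _ X0 _).
  + by rewrite leq_add2l dvdn_leq_log ?cardSg ?meet_groupSl.
  + by apply: subset_trans XE _; rewrite subsetDl.
  + by apply: contraTneq eE => <-; apply/negP=> /(subsetP XE); rewrite !inE eqxx.
exists x; first by rewrite -(lcoset_eqP bW); apply: subsetP xb; rewrite mulgS.
move=> i iE; have [->|ie] := eqVneq i e; last by rewrite xE // !inE ie.
by rewrite (disjointFr be xb).
Qed.

(** Stated for an arbitrary coset and subfamily [C], so that the induction can be applied to
    [b *: W'] and [D]. *)
Lemma minimal_lcoset_cover C W a : p.-group W ->
  (forall x, x \in a *: W -> exists2 i, i \in C & x \in v i *: H i) ->
  (forall j, j \in C -> exists2 x, x \in a *: W &
     forall i, i \in C -> x \in v i *: H i -> i = j) ->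
  (logn p #|W| <= #|C| + logn p #|meet_group W C|)%N.
Proof.
have [n] := ubnP #|C|; elim: n C W a => // n IHn C W a.
rewrite ltnS => leCn pW cover private.
pose P X := (X \subset C) && (logn p #|W| <= #|X| + logn p #|meet_group W X|)%N.
have [/existsP[X /andP[X0 PX]]|/existsPn noP] := boolP [exists X, (X != set0) && P X];
  last first.
  have [|x xW xC] := @lcosets_not_cover C W a pW.
    move=> X XC; have [->|X0] := eqVneq X set0.
      by rewrite cards0 meet_group0.
    by have := noP X; rewrite X0 /P XC /= -ltnNge => /ltnW.
  by have [i iC xi] := cover x xW; have := xC i iC; rewrite xi.
have [Y maxY XY] := maxset_exists PX.
have /andP[YC leY] := maxsetp maxY.
have [CY|[h hCY]] := set_0Vmem (C :\: Y).
  suff -> : C = Y by [].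
  by apply/eqP; rewrite eqEsubset YC -setD_eq0 CY eqxx.
have /andP[hY hC] : (h \notin Y) && (h \in C) by move: hCY; rewrite inE.
have [b bW bh] := private h hC.
pose W' := meet_group W Y.
have sW' : b *: W' \subset a *: W.
  by rewrite -(lcoset_eqP bW) mulgS ?meet_group_sub.
pose covers D := [forall x in b *: W', exists i in D, x \in v i *: H i].
(* A member indexed by [Y] that meets [b *: W'] contains [b], whose only member is [h], and [h] is
   outside [Y]. *)
have covCY : covers (C :\: Y).
  apply/forall_inP => x xb; have [i iC xi] := cover x (subsetP sW' x xb).
  apply/exists_inP; exists i => //; rewrite inE iC andbT; apply: contra hY => iY.
  rewrite -(bh i iC) // -(lcoset_eqP xi) lcoset_sym.
  by apply: subsetP xb; rewrite mulgS ?meet_group_subH.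
have [D minD DCY] := minset_exists covCY.
have /forall_inP covD := minsetp minD.
have [DC dDY] : D \subset C /\ [disjoint D & Y].
  by move: DCY; rewrite subsetD => /andP[].
have hD : h \in D.
  have /exists_inP[i iD bi] := covD b (lcoset_refl _ _).
  by rewrite -(bh i (subsetP DC i iD) bi).
have leD : (logn p #|W'| <= #|D| + logn p #|meet_group W' D|)%N.
  apply: (IHn _ _ b).
  - apply: leq_trans leCn; apply: leq_ltn_trans (subset_leq_card DCY) _.
    apply: proper_card; have [i iX] := set0Pn _ X0.
    rewrite properE subsetDl; apply/subsetPn.
    by exists i; rewrite ?inE ?(subsetP YC) ?(subsetP XY).
  - exact: pgroupS (meet_group_sub _ _) pW.
  - by move=> x /covD /exists_inP.
  (* Minimality of [D]: a point left uncovered by [D :\ j] is private to [j]. *)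
  - move=> j jD; have [|x /= xb xD] := @forall_inPn _ (mem (b *: W'))
      (fun x => [exists i in D :\ j, x \in v i *: H i]) _.
      apply/negP => covDj.
      have /setP/(_ j) := minsetinf minD covDj (subsetDl _ _).
      by rewrite !inE jD eqxx.
    exists x => // i iD xi; apply/eqP; apply: contraNT xD => ij.
    by apply/exists_inP; exists i => //; rewrite !inE ij.
(* The bounds for [Y] in [W] and for [D] in [W'] add up; since [h] is in [D] but not in [Y], this
   contradicts the maximality of [Y]. *)
have PYD : P (Y :|: D).
  rewrite /P subUset YC DC !andTb -meet_groupU.
  rewrite cardsU setIC (disjoint_setI0 dDY) cards0 subn0 -addnA.
  by rewrite (leq_trans leY) // leq_add2l.
have /setP/(_ h) := maxsetsup maxY PYD (subsetUl _ _).
by rewrite !inE hD (negPf hY) orbT.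
Qed.

End CosetCoverings.

From mathcomp Require Import all_order all_algebra.
From mathcomp Require Import all_classical all_reals.
Import Order.TTheory GRing.Theory Num.Theory.
Local Open Scope ring_scope.

(** * From affine hyperplanes to cosets *)

Definition vspace_group {F : finFieldType} {n : nat} (H : {vspace 'rV[F]_n}) :
  {group 'rV[F]_n}.
Proof.
apply: (@Group _ [set x | x \in H]%SET); apply/group_setP; split.
  by rewrite inE mem0v.
by move=> x y; rewrite !inE; apply: memvD.
Defined.

Lemma mem_lcoset_vspace_group (F : finFieldType) (n : nat)
  (H : {vspace 'rV[F]_n}) (v x : 'rV[F]_n) :
  (x \in (v *: vspace_group H)%g) <-> translate H v x.
Proof.
rewrite mem_lcoset inE FinRing.zmodMgE FinRing.zmodVgE addrC; split=> [xH|[h hH <-]].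
  by exists (x - v); rewrite ?subrK.
by rewrite addrK.
Qed.

Lemma hyperplane_covering_size (F : finFieldType) (p m n k : nat) :
  prime p -> #|F| = (p ^ m)%N -> @has_hyperplane_covering F 'rV[F]_n k ->
  (m * n <= k)%N.
Proof.
move=> p_pr cardF [H [v [_ [cover minimal] capH]]].
pose G i := vspace_group (H i).
have cardV : #|[set: 'rV[F]_n]| = (p ^ (m * n))%N.
  by rewrite cardsT card_mx mul1n cardF expnM.
have pV : (p.-group [set: 'rV[F]_n])%g by rewrite /pgroup cardV pnatX pnat_id.
have inV x : x \in (1 *: [set: 'rV[F]_n])%g by rewrite mem_lcoset inE.
have := @minimal_lcoset_cover _ _ G p p_pr v [set: 'I_k]%SET [group of [set: 'rV[F]_n]] 1%g pV.
rewrite cardV pfactorK // cardsT card_ord.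
have -> : meet_group G [group of [set: 'rV[F]_n]] [set: 'I_k]%SET = 1%G.
  apply/trivGP/fintype.subsetP => x /setIP[_ /bigcapP xG].
  rewrite inE -[_ == _]/(x == 0) -memv0 -capH memvE.
  by apply/subv_bigcapP => i _; have := xG i; rewrite !inE memvE => ->.
rewrite cards1 logn1 addn0; apply=> [x _|j _].
  have [i _ xi] : (\bigcup_i translate (H i) (v i))%classic x by rewrite cover.
  by exists i; [rewrite inE | apply/mem_lcoset_vspace_group].
have [x xj] : exists x, ~ (\bigcup_(i in [set~ j]) translate (H i) (v i))%classic x.
  apply: contrapT => all; apply: (minimal j); rewrite -subTset => x _.
  by apply: contrapT => nx; apply: all; exists x.
exists x => // i _ /mem_lcoset_vspace_group xi.
by apply: contrapT => ij; apply: xj; exists i.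
Qed.

Theorem theorem11 (R : realType) (q p m : nat) (hp : prime p) (hm : (0 < m)%N)
  (hq : q = (p ^ m)%N) (F : finFieldType) (hF : #|F| = q) (hnp : ~~ prime q) :
  1 / 2 <= epsilon R F.
Proof.
have m_ge2 : (1 < m)%N.
  by move: m hm hq => [|[|m]] // _ hq; rewrite hq expn1 hp in hnp.
(* The bound [m * n <= lq F n] with [m >= 2] makes every ratio at least 2. *)
suff : 1 <= epsilon R F.
  by apply: le_trans; rewrite ler_pdivrMr ?ltr0n // mul1r ler1n.
rewrite /epsilon lerBrDr -[1 + 1]/(2%:R); apply: lb_le_inf.
  by exists ((lq F 1)%:R / 1%:R), 1%N.
move=> _ [n /= n_gt0 <-]; rewrite ler_pdivlMr ?ltr0n // -natrM ler_nat.
have [covering _] := lqP F n_gt0.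
apply: leq_trans (hyperplane_covering_size F p m n _ hp _ covering); last by rewrite hF.
by rewrite leq_mul2r m_ge2 orbT.
Qed.
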